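(* Let $k$ be a power of a prime and let $S\subseteq\mathcal{L}_k$ be nonempty. If an $n$-vertex graph $G$ with $m$ edges is $S$-$k$-colorable and $m\le (k-1)n$, then $$P_S(G,k)\ge k^{\,n-\frac{m}{k-1}}.$$ In particular, $P_{\mathcal{L}_k}(G,k)\ge k^{\,n-\frac{m}{k-1}}$ whenever $G$ is $\mathcal{L}_k$-$k$-colorable and $m\le(k-1)n$.
   Context: $\mathbb{F}_k$ is the finite field with $k$ elements. A polynomial $f\in\mathbb{F}_k[x,y]$ covers a permutation $\pi$ of $\mathbb{F}_k$ if $f(x,\pi(x))=0$ for all $x\in\mathbb{F}_k$; $\pi$ is $\mathbb{F}_k$-linear if some polynomial of degree one in $\mathbb{F}_k[x,y]$ covers it. $\mathcal{L}_k\subseteq S_{\mathbb{F}_k}$ is the set of $\mathbb{F}_k$-linear permutations. For a finite set $A$ and nonempty $S\subseteq S_A$ (here $A=\mathbb{F}_k$), an $S$-labeling of a graph $G$ is a pair $(D,\sigma)$ with $D$ an orientation of $G$ and $\sigma:E(D)\to S$ (for multigraphs, $D$ orients the underlying simple graph and $\sigma(u,v)$ is a tuple of elements of $S$, one per parallel edge). A proper $S$-coloring of $(D,\sigma)$ is $\kappa:V(G)\to A$ with $\pi(\kappa(u))\ne\kappa(v)$ for every arc $(u,v)$ and every permutation $\pi$ assigned to it; it is a proper $S$-$k$-coloring if it uses at most $k$ colors. $G$ is $S$-$k$-colorable if every $S$-labeling of $G$ has a proper $S$-$k$-coloring. $P_S(G,k)$ is the minimum over all $S$-labelings of $G$ of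 the number of proper $S$-$k$-colorings. *)

(* Defs.v *)
From mathcomp Require Import all_boot all_order all_fingroup all_algebra.
From mathcomp Require Import boolp.
From mathcomp Require Import mpoly.

Set Implicit Arguments.
Unset Strict Implicit.
Unset Printing Implicit Defensive.

(* Finite loopless multigraphs; simple graphs are those with [ends] injective. *)
Record multigraph := Multigraph {
  vertex : finType;
  edge : finType;
  ends : edge -> {set vertex};
  ends_card : forall e, #|ends e| = 2 }.

Definition nvertices (G : multigraph) : nat := #|vertex G|.
Definition nedges (G : multigraph) : nat := #|edge G|.

Definition adjacent (G : multigraph) (u v : vertex G) : bool :=
  [exists e : edge G, ends e == [set u; v]].

(* An orientation of the underlying simple graph, given by its set of arcs. *)
Definition is_orientation (G : multigraph) (D : {set vertex G * vertex G}) :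
    bool :=
  [forall u, forall v,
    if adjacent u v then ((u, v) \in D) (+) ((v, u) \in D)
    else (u, v) \notin D].

(* The labels are indexed by the edges of [G]: the tuple assigned to an arc
   (u, v) is the family of labels of the parallel edges with ends u and v. *)
Definition prelabeling (A : finType) (G : multigraph) : finType :=
  ({set vertex G * vertex G} * {ffun edge G -> {perm A}})%type.

Definition is_labeling (A : finType) (S : {set {perm A}}) (G : multigraph)
    (L : prelabeling A G) : bool :=
  is_orientation L.1 && [forall e, L.2 e \in S].

Definition is_proper (A : finType) (G : multigraph) (L : prelabeling A G)
    (kappa : {ffun vertex G -> A}) : bool :=
  [forall u, forall v, forall e : edge G,
    ((u, v) \in L.1) && (ends e == [set u; v]) ==>
      (L.2 e (kappa u) != kappa v)].

Definition proper_colorings (A : finType) (G : multigraph)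
    (L : prelabeling A G) (k : nat) : {set {ffun vertex G -> A}} :=
  [set kappa | is_proper L kappa & #|[set kappa u | u : vertex G]| <= k].

Definition colorable (A : finType) (S : {set {perm A}}) (G : multigraph)
    (k : nat) : Prop :=
  forall L : prelabeling A G, is_labeling S L ->
    exists kappa, kappa \in proper_colorings L k.

(* The minimum over all labelings.  The neutral element is the number of all
   maps V(G) -> A, an upper bound of every term, so that it does not affect the
   minimum when there is a labeling, i.e. when [S] is nonempty: see [PS_min]. *)
Definition PS (A : finType) (S : {set {perm A}}) (G : multigraph) (k : nat) :
    nat :=
  \big[minn/#|{ffun vertex G -> A}|]_(L : prelabeling A G | is_labeling S L)
    #|proper_colorings L k|.

Definition covers (F : finFieldType) (f : {mpoly F[2]}) (pi : {perm F}) : Prop :=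
  forall x : F, f.@[fun i : 'I_2 => if i == ord0 then x else pi x] = 0%R.

(* [msize f] is the total degree of [f] plus one when [f] is nonzero, and 0
   when [f] is zero. *)
Definition is_linear_perm (F : finFieldType) (pi : {perm F}) : Prop :=
  exists2 f : {mpoly F[2]}, msize f = 2 & covers f pi.

Definition linear_perms (F : finFieldType) : {set {perm F}} :=
  [set pi | `[< is_linear_perm pi >]].

Lemma orientation_exists (G : multigraph) :
  exists D : {set vertex G * vertex G}, is_orientation D.
Proof.
exists [set p | adjacent p.1 p.2 & enum_rank p.1 < enum_rank p.2].
apply/forallP => u; apply/forallP => v; rewrite !inE /=.
have -> : adjacent v u = adjacent u v.
  by rewrite /adjacent; apply: eq_existsb => e; rewrite setUC.
case: (boolP (adjacent u v)) => [/existsP[e /eqP eE]|//] /=.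
have uv : u != v.
  by apply/negP => /eqP uv; have := ends_card e; rewrite eE uv setUid cards1.
case: ltngtP => // /ord_inj /enum_rank_inj /eqP.
by rewrite (negPf uv).
Qed.

Lemma bigminn_le (T : eqType) (r : seq T) (P : pred T) (F : T -> nat) (x0 : nat)
    (x : T) : x \in r -> P x -> \big[minn/x0]_(i <- r | P i) F i <= F x.
Proof.
move=> + Px; elim: r => //= y r IH; rewrite inE big_cons.
case/orP => [/eqP <-|/IH le_r]; first by rewrite Px geq_minl.
by case: ifP => // _; apply: leq_trans (geq_minr _ _) le_r.
Qed.

Lemma PS_min (A : finType) (S : {set {perm A}}) (G : multigraph) (k : nat) :
  S != set0 ->
  (exists2 L : prelabeling A G, is_labeling S L &
     PS S G k = #|proper_colorings L k|) /\
  (forall L : prelabeling A G, is_labeling S L ->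
     PS S G k <= #|proper_colorings L k|).
Proof.
move=> /set0Pn[s sS]; have [D oD] := orientation_exists G.
have labP : is_labeling S (D, [ffun=> s] : {ffun edge G -> {perm A}}).
  by rewrite /is_labeling /= oD; apply/forallP => e; rewrite ffunE.
have le_PS (L : prelabeling A G) : is_labeling S L -> PS S G k <= #|proper_colorings L k|.
  by move=> labL; rewrite /PS; apply: bigminn_le labL; rewrite mem_index_enum.
split=> //.
have : PS S G k = #|{ffun vertex G -> A}| \/
    exists2 L : prelabeling A G, is_labeling S L &
      PS S G k = #|proper_colorings L k|.
  rewrite /PS; elim/big_ind: _ => [|x y Hx Hy|L labL]; first by left.
    by rewrite /minn; case: ifP.
  by right; exists L.
case=> // PSE; exists (D, [ffun=> s] : {ffun edge G -> {perm A}}) => //.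
by apply/eqP; rewrite eqn_leq le_PS //= PSE max_card.
Qed.

(* Main.v *)
(* A linear permutation has the form [x |-> a x + b], so the proper colorings of
   a labeling are the nonzeros over F_q of a product of [m] affine forms in [n]
   variables, where [q = k], and this product does not vanish identically.  A function of
   degree at most [m] which does not vanish identically has at least
   [q ^ (n - m / (q - 1))] nonzeros (Alon-Furedi), by induction on [n]: if [t] is
   its degree in the first variable, each nonzero of the leading coefficient,
   which has degree at most [m - t], extends to at least
   [q - t >= q ^ (1 - t / (q - 1))] nonzeros. *)

Require Import Defs.
From mathcomp Require Import all_boot all_order all_fingroup all_algebra.
From mathcomp Require Import reals exp.
From mathcomp Require Import finfield mpoly boolp ring.
From mathcomp Require Import interval_inference convex sequences.

Set Implicit Arguments.
Unset Strict Implicit.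
Unset Printing Implicit Defensive.

Import Order.TTheory GRing.Theory Num.Theory.

Local Open Scope ring_scope.

(** * Degree of reduced polynomial functions over a finite field *)

Section ReducedDegree.

Variable F : finFieldType.
Implicit Types (n m : nat) (f g : seq F -> F).

(* On the points of length [n], [f] is a polynomial function of total degree at
   most [m] and of degree less than [#|F|] in each variable. *)
Fixpoint reduced_degree_le n m f : Prop :=
  if n is n'.+1 then
    exists g : nat -> seq F -> F,
      (forall i, (i <= m)%N -> reduced_degree_le n' (m - i) (g i)) /\
      (forall x s, size s = n' ->
         f (x :: s) = \sum_(i < #|F| | (i <= m)%N) g i s * x ^+ i)
  else True.

Lemma eq_reduced_degree_le n m f1 f2 :
  (forall s, size s = n -> f1 s = f2 s) ->
  reduced_degree_le n m f1 -> reduced_degree_le n m f2.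
Proof.
case: n => //= n eq_f [g [gP fE]]; exists g; split=> // x s sn.
by rewrite -eq_f ?fE //= sn.
Qed.

Lemma reduced_degree_le0 n m : reduced_degree_le n m (fun=> 0).
Proof.
elim: n m => //= n IH m; exists (fun _ _ => 0); split=> // x s _.
by rewrite big1 // => i _; rewrite mul0r.
Qed.

Lemma reduced_degree_leW n m1 m2 f :
  (m1 <= m2)%N -> reduced_degree_le n m1 f -> reduced_degree_le n m2 f.
Proof.
elim: n m1 m2 f => //= n IH m1 m2 f le_m [g [gP fE]].
exists (fun i s => if (i <= m1)%N then g i s else 0); split=> [i _|x s sn].
  case: leqP => [le_i|_]; last exact: reduced_degree_le0.
  by apply: IH (gP i le_i); apply: leq_sub2r.
rewrite fE // big_mkcond [RHS]big_mkcond; apply: eq_bigr => i _.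
case: leqP => [le_i|_]; last by rewrite mul0r if_same.
by rewrite (leq_trans le_i).
Qed.

Lemma reduced_degree_leD n m f1 f2 :
  reduced_degree_le n m f1 -> reduced_degree_le n m f2 ->
  reduced_degree_le n m (fun s => f1 s + f2 s).
Proof.
elim: n m f1 f2 => //= n IH m f1 f2 [g1 [g1P f1E]] [g2 [g2P f2E]].
exists (fun i s => g1 i s + g2 i s); split=> [i le_i|x s sn].
  by apply: IH; [apply: g1P | apply: g2P].
by rewrite f1E // f2E // -big_split /=; apply: eq_bigr => i _; rewrite mulrDl.
Qed.

Lemma reduced_degree_leZ n m c f :
  reduced_degree_le n m f -> reduced_degree_le n m (fun s => c * f s).
Proof.
elim: n m f => //= n IH m f [g [gP fE]].
exists (fun i s => c * g i s); split=> [i le_i|x s sn]; first by apply/IH/gP.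
by rewrite fE // mulr_sumr; apply: eq_bigr => i _; rewrite mulrA.
Qed.

Lemma reduced_degree_le_cst n m c : reduced_degree_le n m (fun=> c).
Proof.
elim: n m => //= n IH m; exists (fun i _ => if i is 0%N then c else 0).
split=> [[|i] _|x s _]; [exact: IH | exact: reduced_degree_le0 |].
have q0 : (0 < #|F|)%N by apply/card_gt0P; exists 0.
rewrite (bigD1 (Ordinal q0)) //= mulr1 big1 ?addr0 // => -[[|i] ltiq] //=.
by rewrite mul0r.
Qed.

(** Reduction modulo [x ^ q - x] never raises the degree, so a product with a variable costs at most
    one. Variables other than the first pass to the coefficients by induction. *)
Lemma reduced_degree_leX n m j f :
  reduced_degree_le n m f -> reduced_degree_le n m.+1 (fun s => s`_j * f s).
Proof.
elim: n m j f => //= n IH m [|j] f [g [gP fE]]; last first.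
  exists (fun i s => if (i <= m)%N then s`_j * g i s else 0).
  split=> [i _|x s sn].
    case: leqP => [le_i|_]; last exact: reduced_degree_le0.
    by rewrite subSn //; apply/IH/gP.
  rewrite fE //= mulr_sumr big_mkcond [RHS]big_mkcond; apply: eq_bigr => i _.
  case: leqP => [le_i|_]; last by rewrite mul0r if_same.
  by rewrite leqW // mulrA.
(* Since [x ^+ q = x], the coefficient [g (q - 1)] moves to degree 1. *)
pose q1 := #|F|.-1.
have q_gt1 : (1 < #|F|)%N := card_finNzRing_gt1 F.
have qE : #|F| = q1.+1 by rewrite prednK // ltnW.
have q1_gt0 : (0 < q1)%N by rewrite -ltnS -qE.
exists (fun i s => if i is i'.+1 then
  g i' s + (if (i' == 0)%N && (q1 <= m)%N then g q1 s else 0) else 0).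
split=> [[|i] lti|x s sn]; first exact: reduced_degree_le0.
  rewrite subSS; apply: reduced_degree_leD; first exact: gP.
  case: eqP => [->|_] /=; last exact: reduced_degree_le0.
  case: leqP => [le_q|_]; last exact: reduced_degree_le0.
  by rewrite subn0; apply: reduced_degree_leW (gP _ le_q); apply: leq_subr.
have xq : x ^+ q1.+1 = x by rewrite -qE expf_card.
rewrite fE //= qE mulr_sumr big_mkcond big_ord_recr /=.
rewrite [RHS]big_mkcond big_ord_recl /= mul0r add0r.
(* Each summand is the shifted term plus, at index 0 alone, the wrapped term
   [x * (g q1 s * x ^+ q1)], which matches the last term split off on the left. *)
rewrite [in RHS](eq_bigr (fun i : 'I_q1 =>
    (if (i <= m)%N then x * (g i s * x ^+ i) else 0)
    + (if (nat_of_ord i == 0)%N && (q1 <= m)%N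
       then x * (g q1 s * x ^+ q1) else 0))); last first.
  move=> i _; rewrite -[LHS]/(if (i.+1 <= m.+1)%N then
    (g i s + (if (nat_of_ord i == 0)%N && (q1 <= m)%N then g q1 s else 0))
      * x ^+ i.+1 else 0) ltnS exprS.
  case: eqP => [i0|_] /=; last first.
    by rewrite !addr0; case: ifP => // _; rewrite mulrCA.
  rewrite i0 leq0n expr0 !mulr1 mulrDl mulrC; congr (_ + _).
  by case: ifP => _; rewrite ?mul0r // mulrCA -exprS xq mulrC.
rewrite big_split /=; congr (_ + _).
rewrite (bigD1 (Ordinal q1_gt0)) //= big1 ?addr0 // => i.
by rewrite -val_eqE /= => /negPf ->.
Qed.

(** Each factor is a combination of two variables and a constant, so it adds at most one to the
    degree. *)
Lemma reduced_degree_le_affine_prod n (E : Type) (r : seq E)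
    (a b : E -> F) (i j : E -> nat) :
  reduced_degree_le n (size r)
    (fun s => \prod_(e <- r) (a e * s`_(i e) + b e - s`_(j e))).
Proof.
elim: r => [|e r IH] /=.
  apply: eq_reduced_degree_le (reduced_degree_le_cst _ _ 1) => s _.
  by rewrite big_nil.
pose P s := \prod_(e <- r) (a e * s`_(i e) + b e - s`_(j e)).
apply: (eq_reduced_degree_le (f1 :=
  fun s => a e * (s`_(i e) * P s) + b e * P s + -1 * (s`_(j e) * P s))).
  by move=> s _; rewrite big_cons -/(P s); ring.
apply: reduced_degree_leD; last exact/reduced_degree_leZ/reduced_degree_leX.
apply: reduced_degree_leD; first exact/reduced_degree_leZ/reduced_degree_leX.
exact/reduced_degree_leZ/(reduced_degree_leW (leqnSn _)).
Qed.

End ReducedDegree.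

(** * Counting nonzeros of a function of bounded degree *)

Lemma card_tuple_cons (T : finType) n (P : pred (seq T)) :
  #|[set t : n.+1.-tuple T | P t]| =
  (\sum_(t : n.-tuple T) #|[set x | P (x :: t)]|)%N.
Proof.
rewrite -sum1dep_card.
rewrite (eq_bigr (fun t : n.-tuple T => \sum_(x | P (x :: t)) 1)%N); last first.
  by move=> t _; rewrite -sum1dep_card.
rewrite pair_big_dep /=.
rewrite (reindex (fun p : n.-tuple T * T => cons_tuple p.2 p.1)) //=.
exists (fun t : n.+1.-tuple T => ([tuple of behead t], thead t)) => /=
  [[t x] _|t _].
  by congr (_, _); apply: val_inj.
by rewrite [RHS]tuple_eta; apply: val_inj.
Qed.

(* The chord of [expR] over the segment from 0 to [ln q]. *)
Lemma powR_le_subn (R : realType) (q t : nat) : (1 < q)%N -> (t <= q - 1)%N ->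
  (q%:R : R) `^ (1 - t%:R / (q - 1)%:R) <= (q - t)%:R.
Proof.
move=> q1 tq.
have q10 : 0 < (q - 1)%:R :> R by rewrite ltr0n subn_gt0.
have q0 : 0 < q%:R :> R by rewrite ltr0n ltnW.
pose u : R := 1 - t%:R / (q - 1)%:R.
have u0 : 0 <= u by rewrite subr_ge0 ler_pdivrMr // mul1r ler_nat.
have u1 : u <= 1 by rewrite lerBlDr lerDl divr_ge0 ?ler0n.
have := convex_expR (Itv01 u0 u1) (ln (q%:R : R)) 0.
rewrite !convRE /= mulr0 addr0 expR0 mulr1 lnK ?posrE // /powR gt_eqF //.
(* The chord has height [u * q + (1 - u)] at [u], and this is exactly [q - t]. *)
move/le_trans; apply; rewrite le_eqVlt; apply/orP; left; apply/eqP.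
rewrite /unstable.onem /u !natrB ?(ltnW q1) ?(leq_trans tq) ?leq_subr // in q10 *.
by field; rewrite gt_eqF.
Qed.

Lemma alon_furedi_count (R : realType) (F : finFieldType) n m (f : seq F -> F) :
  reduced_degree_le n m f -> (exists t : n.-tuple F, f t != 0) ->
  (#|F|%:R : R) `^ (n%:R - m%:R / (#|F| - 1)%:R)
    <= #|[set t : n.-tuple F | f t != 0]|%:R.
Proof.
set q := #|F|; have q_gt1 : (1 < q)%N := card_finNzRing_gt1 F.
have q1_gt0 : 0 < (q - 1)%:R :> R by rewrite ltr0n subn_gt0.
have q_neq0 : (q%:R : R) != 0 by rewrite pnatr_eq0 -lt0n ltnW.
elim: n m f => [|n IH] m f fP [t0 ft0].
  (* Without variables the exponent is nonpositive, so the power is at most 1, and [t0] is one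
     nonzero. *)
  apply: (@le_trans _ _ 1); last first.
    by rewrite ler1n; apply/card_gt0P; exists t0; rewrite inE.
  rewrite -[leRHS](powRr0 q%:R); apply: ler_powR; first by rewrite ler1n ltnW.
  by rewrite sub0r oppr_le0 divr_ge0 ?ler0n.
case: fP => g [gP fE].
(* The degree [t] in the first variable is the largest index whose coefficient is not identically
   zero on the tails. *)
pose nz i := [&& (i < q)%N, (i <= m)%N & [exists s : n.-tuple F, g i s != 0]].
have ex_nz : exists i, nz i.
  case/tupleP: t0 ft0 => x s; rewrite fE ?size_tuple // => fxs.
  suff /exists_inP[i le_i gi] : [exists (i : 'I_q | (i <= m)%N), g i s != 0].
    by exists i; rewrite /nz ltn_ord le_i; apply/existsP; exists s.
  apply: contraR fxs => /exists_inPn g0; apply/eqP/big1 => i le_i.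
  have /g0/negPn/eqP -> : i \in [pred i : 'I_q | (i <= m)%N] by [].
  by rewrite mul0r.
have nz_le i : nz i -> (i <= m)%N by case/and3P.
case: (ex_maxnP ex_nz nz_le) => t /and3P[lt_tq le_tm /existsP gt0] t_max.
have count_x (s : n.-tuple F) : g t s != 0 ->
    (q - t <= #|[set x | f (x :: s) != 0%R]|)%N.
  (* For a fixed tail [s] with [g t s != 0], the function of [x] is a polynomial of degree exactly
     [t], hence has at most [t] roots; coefficients above [t] vanish by maximality. *)
  move=> gts; pose P := \poly_(i < t.+1) g i s.
  have szP : size P = t.+1 by rewrite size_poly_eq.
  have P0 : P != 0 by rewrite -size_poly_eq0 szP.
  have fP x : f (x :: s) = P.[x].
    rewrite fE ?size_tuple // horner_poly.
    rewrite (big_ord_widen q (fun i => g i s * x ^+ i)) //.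
    rewrite big_mkcond [RHS]big_mkcond; apply: eq_bigr => i _ /=.
    rewrite ltnS; case: (leqP i t) => [le_it|lt_ti].
      by rewrite (leq_trans le_it).
    case: leqP => // le_im; case: (eqVneq (g i s) 0) => [->|gis].
      by rewrite mul0r.
    have : nz i by rewrite /nz ltn_ord le_im; apply/existsP; exists s.
    by move/t_max; rewrite leqNgt lt_ti.
  rewrite leq_subLR -[q](cardsC [set x | f (x :: s) != 0]) addnC leq_add2r.
  rewrite cardE -ltnS -szP; apply: max_poly_roots => //; last exact: enum_uniq.
  by apply/allP => x; rewrite mem_enum !inE negbK fP.
have count_f : (#|[set s : n.-tuple F | g t s != 0%R]| * (q - t)
    <= #|[set u : n.+1.-tuple F | f u != 0%R]|)%N.
  rewrite (card_tuple_cons _ (fun s => f s != 0)) -sum_nat_const big_mkcond /=.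
  apply: leq_sum => s _; rewrite inE; case: ifP => // /count_x.
  exact.
apply: le_trans
  (_ : _ <= (#|[set s : n.-tuple F | g t s != 0%R]| * (q - t))%:R) _; last first.
  by rewrite ler_nat.
(* The exponent splits into that of the induction hypothesis for [g t], of degree at most [m - t],
   and that of the chord bound for [q - t]. *)
have -> : n.+1%:R - m%:R / (q - 1)%:R =
    (n%:R - (m - t)%:R / (q - 1)%:R) + (1 - t%:R / (q - 1)%:R) :> R.
  by rewrite (natrB _ le_tm) -natr1; field; rewrite gt_eqF.
rewrite powRD ?q_neq0 ?implybT // natrM; apply: ler_pM; rewrite ?powR_ge0 //.
  exact: IH (gP _ le_tm) gt0.
by apply: powR_le_subn => //; rewrite leq_subRL ?add1n // ltnW.
Qed.

(** * Linear permutations as affine maps *)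

Lemma linear_permP (F : finFieldType) (pi : {perm F}) :
  is_linear_perm pi -> exists a b, forall x, pi x = a * x + b.
Proof.
case=> P szP covP.
pose c0 := P@_0; pose c1 := P@_U_(ord0); pose c2 := P@_U_(ord_max).
have PE : P = c0%:MP + c1 *: 'X_ord0 + c2 *: 'X_ord_max.
  apply/mpolyP => m; rewrite !mcoeffD !mcoeffZ mcoeffC !mcoeffX.
  have [lt1m|le_m1] := ltnP 1 (mdeg m).
    rewrite memN_msupp_eq0 ?msize_mdeg_ge ?szP //.
    have m_neq m' : (mdeg m' < mdeg m)%N -> (m' == m) = false.
      by move=> lt_m; apply/negP => /eqP mE; rewrite mE ltnn in lt_m.
    rewrite [m == _]eq_sym !m_neq ?mdeg1 ?mdeg0 ?(ltnW lt1m) //.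
    by rewrite !mulr0 !addr0.
  case: (posnP (mdeg m)) => [/eqP|m_gt0].
    by rewrite mdeg_eq0 => /eqP ->; rewrite eqxx !mnm1_eq0 mulr1 !mulr0 !addr0.
  have /mdeg1P[i /eqP ->] : mdeg m == 1%N by rewrite eqn_leq le_m1.
  rewrite mnm1_eq0 !eq_mnm1 mulr0 add0r.
  have [->|->] : i = ord0 \/ i = ord_max.
    by case: i => -[|[|//]] lti; [left | right]; apply: val_inj.
    by rewrite eqxx mulr1 mulr0 addr0.
  by rewrite eqxx mulr1 mulr0 add0r.
have covE x : c0 + c1 * x + c2 * pi x = 0.
  by have := covP x; rewrite PE !mevalD !mevalZ mevalC !mevalXU.
(* If [c2] were 0, then [c0 + c1 * x] would vanish at 0 and 1, forcing [P = 0] against its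
   degree. *)
have c2_neq0 : c2 != 0.
  apply/eqP => c20; move: covE; rewrite c20 => covE.
  have c00 : c0 = 0 by have := covE 0; rewrite mulr0 mul0r !addr0.
  have c10 : c1 = 0 by have := covE 1; rewrite mulr1 c00 mul0r addr0 add0r.
  by move: szP; rewrite PE c00 c10 c20 !scale0r mpolyC0 !addr0 msize0.
exists (- (c1 / c2)), (- (c0 / c2)) => x.
apply: (mulfI c2_neq0); have /eqP := covE x; rewrite addrC addr_eq0 => /eqP ->.
by field.
Qed.

(** * Proper colorings as nonzeros of a product of affine forms *)

Section AffineLabeling.

Variables (F : finFieldType) (G : multigraph).
Implicit Types (L : prelabeling F G) (kappa : {ffun vertex G -> F}).

Lemma orientation_arc D : is_orientation D ->
  forall e : edge G, exists p : vertex G * vertex G,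
    p \in D /\ ends e = [set p.1; p.2].
Proof.
move=> oD e; have /eqP/cards2P[u [v [_ eE]]] := ends_card e.
have adj : Defs.adjacent u v by apply/existsP; exists e; rewrite eE.
have /forallP/(_ u)/forallP/(_ v) := oD; rewrite adj.
by case: (boolP ((u, v) \in D)) => [Duv _|_ /= Dvu];
  [exists (u, v) | exists (v, u); rewrite setUC in eE].
Qed.

(** Only one of the two directions of an edge lies in [D], so the arc chosen for each edge is the
    one that [is_proper] tests. *)
Lemma orientation_uniq D : is_orientation D ->
  forall (e : edge G) u v u' v', (u, v) \in D -> (u', v') \in D ->
    ends e = [set u; v] -> ends e = [set u'; v'] -> (u, v) = (u', v').
Proof.
move=> oD e u v u' v' Duv Duv' eE eE'.
have adj : Defs.adjacent u v by apply/existsP; exists e; rewrite eE.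
have /forallP/(_ u)/forallP/(_ v) := oD; rewrite adj Duv /= => Dvu.
have u'E : u' \in [set u; v] by rewrite -eE eE' set21.
have v'E : v' \in [set u; v] by rewrite -eE eE' set22.
have uv' : u' != v'.
  by apply/eqP => uv; have := ends_card e; rewrite eE' uv setUid cards1.
move: u'E v'E uv' Duv'; rewrite !inE.
case/pred2P=> -> /pred2P[] ->; rewrite ?eqxx // => _ Dvu'.
by rewrite Dvu' in Dvu.
Qed.

Lemma card_proper_colorings_ge (R : realType) L :
  is_orientation L.1 -> (forall e, is_linear_perm (L.2 e)) ->
  (exists kappa, kappa \in proper_colorings L #|F|) ->
  (#|F|%:R : R) `^ ((nvertices G)%:R - (nedges G)%:R / (#|F| - 1)%:R)
    <= #|proper_colorings L #|F| |%:R.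
Proof.
move=> oD linL [kappa]; rewrite inE => /andP[/forallP kappaP _].
have /fin_all_exists[arc arcP] := orientation_arc oD.
have /fin_all_exists[a /fin_all_exists[b abE]] :=
  fun e => linear_permP (linL e).
pose rk (u : vertex G) : nat := enum_rank u.
pose f s := \prod_(e <- enum (edge G))
  (a e * s`_(rk (arc e).1) + b e - s`_(rk (arc e).2)).
have f_neq0 s : (f s != 0) =
    [forall e, L.2 e s`_(rk (arc e).1) != s`_(rk (arc e).2)].
  rewrite /f prodf_seq_neq0; apply/allP/forallP => [fs e|fs e _].
    by have := fs e (mem_enum _ e); rewrite /= subr_eq0 abE.
  by rewrite /= subr_eq0 -abE.
have f_deg : reduced_degree_le (nvertices G) (nedges G) f.
  by rewrite /nedges cardE; apply: reduced_degree_le_affine_prod.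
(* The given proper coloring, listed along the enumeration of the vertices, shows that [f] is not
   identically zero. *)
apply: le_trans (alon_furedi_count R f_deg _) _.
  exists [tuple kappa (enum_val i) | i < #|vertex G|].
  rewrite f_neq0; apply/forallP => e.
  rewrite -!tnth_nth !tnth_mktuple !enum_rankK.
  have [De eE] := arcP e.
  have /forallP/(_ (arc e).2)/forallP/(_ e) := kappaP (arc e).1.
  by rewrite -surjective_pairing De eE eqxx.
rewrite ler_nat.
(* Reading a tuple as a coloring is injective and sends nonzeros of [f] to proper colorings. *)
pose col (t : (nvertices G).-tuple F) := [ffun u => t`_(rk u)].
have col_inj : injective col.
  move=> t1 t2 /ffunP eq_t; apply: eq_from_tnth => i.
  by have := eq_t (enum_val i); rewrite !ffunE /rk enum_valK -!tnth_nth.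
rewrite -(card_imset _ col_inj); apply: subset_leq_card.
apply/subsetP => _ /imsetP[t + ->]; rewrite !inE f_neq0 => /forallP ft.
rewrite max_card andbT.
apply/forallP => u; apply/forallP => v; apply/forallP => e; apply/implyP.
case/andP=> Duv /eqP eE; rewrite !ffunE; have [De eE'] := arcP e.
rewrite [arc e]surjective_pairing in De.
by have [-> ->] := orientation_uniq oD Duv De eE eE'; apply: ft.
Qed.

End AffineLabeling.

Theorem theorem1p3 (R : realType) (p e k : nat) (hp : prime p) (he : (0 < e)%N)
    (hk : k = (p ^ e)%N) (F : finFieldType) (hF : #|F| = k) :
  (forall S : {set {perm F}}, S != set0 -> S \subset linear_perms F ->
     forall G : multigraph, colorable S G k ->
       (nedges G <= (k - 1) * nvertices G)%N ->
       (k%:R : R) `^ ((nvertices G)%:R - (nedges G)%:R / (k - 1)%:R)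
         <= (PS S G k)%:R) /\
  (forall G : multigraph, colorable (linear_perms F) G k ->
     (nedges G <= (k - 1) * nvertices G)%N ->
     (k%:R : R) `^ ((nvertices G)%:R - (nedges G)%:R / (k - 1)%:R)
       <= (PS (linear_perms F) G k)%:R).
Proof.
have PS_ge S : S != set0 -> S \subset linear_perms F ->
    forall G : multigraph, colorable S G k ->
    (k%:R : R) `^ ((nvertices G)%:R - (nedges G)%:R / (k - 1)%:R)
      <= (PS S G k)%:R.
  (* The minimum is attained at some labeling [L], so it suffices to count the colorings of [L]. *)
  move=> S0 linS G colG; have [[L labL ->] _] := PS_min G k S0.
  have := colG L labL; case/andP: labL => oD /forallP LS.
  rewrite -hF; apply: card_proper_colorings_ge => // e0.
  by have := subsetP linS _ (LS e0); rewrite inE => /asboolP.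
split=> [S S0 linS G colG _|G colG _]; first exact: PS_ge.
apply: PS_ge => //; apply/set0Pn; exists 1%g; rewrite inE; apply/asboolP.
(* The identity is covered by [x - y], so [linear_perms F] is nonempty. *)
exists ('X_ord0 - 'X_ord_max).
  apply/eqP; rewrite eqn_leq; apply/andP; split.
    by rewrite (leq_trans (msizeD_le _ _)) // msizeN !msizeX !mdeg1.
  apply: (@leq_trans (mdeg U_(ord0 : 'I_2)).+1); first by rewrite mdeg1.
  apply: msize_mdeg_lt.
  by rewrite mcoeff_msupp mcoeffB !mcoeffXU eqxx subr0 oner_neq0.
by move=> x; rewrite mevalB !mevalXU /= perm1 subrr.
Qed.
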